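(* Let $T$ be a tournament of order $n\geq 3$. Then $$\frac{n}{2\log_2\left(\frac{2n+2}{3}\right)} \leq dac(T)\leq \left\lceil\frac{n}{2}\right\rceil.$$
   Context: A tournament of order $n$ is an orientation of the complete graph $K_n$ (for each pair of distinct vertices exactly one of the two possible arcs is present). A vertex coloring of a digraph $D$ with $k$ colors is a surjective function $V(D)\to[k]=\{1,\dots,k\}$; the preimages of the colors are the chromatic classes. A coloring is acyclic if no chromatic class induces a subdigraph containing a directed cycle. A coloring is complete if for every ordered pair $(i,j)$ of different colors there is at least one arc $(x,y)$ such that $x$ has color $i$ and $y$ has color $j$. The diachromatic number $dac(D)$ is the largest $k$ such that $D$ has a complete and acyclic coloring with $k$ colors. *)

(* Defs.v *)
From mathcomp Require Import all_boot all_order all_algebra.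
From mathcomp Require Import all_classical all_reals all_analysis.

Set Implicit Arguments.
Unset Strict Implicit.
Unset Printing Implicit Defensive.

Import Order.TTheory GRing.Theory Num.Theory.

Local Open Scope ring_scope.

Definition log2 (R : realType) (x : R) : R := ln x / ln 2.

(* A finite digraph is given by its arc relation on a finite type of vertices. *)
Definition tournament (V : finType) (e : rel V) : Prop :=
  irreflexive e /\ forall x y : V, x != y -> e x y (+) e y x.

Definition surjective_coloring (V : finType) (k : nat) (c : V -> 'I_k) : Prop :=
  forall i : 'I_k, exists x : V, c x = i.

(* A directed cycle is a nonempty duplicate-free sequence that is cyclic for
   the arc relation. It lies in the subdigraph induced by a chromatic class iff
   all its vertices do. *)
Definition acyclic_coloring (V : finType) (e : rel V) (k : nat)
    (c : V -> 'I_k) : Prop :=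
  forall i : 'I_k,
    ~ exists p : seq V,
        [/\ p <> [::], ucycle e p & forall x : V, x \in p -> c x = i].

Definition complete_coloring (V : finType) (e : rel V) (k : nat)
    (c : V -> 'I_k) : Prop :=
  forall i j : 'I_k, i != j ->
    exists x y : V, [/\ e x y, c x = i & c y = j].

Definition dac_colorable (V : finType) (e : rel V) (k : nat) : Prop :=
  exists c : V -> 'I_k,
    [/\ surjective_coloring c, acyclic_coloring e c & complete_coloring e c].

(* Surjectivity forces k <= #|V|, so the bound on k loses nothing: see
   [dac_max]. *)
Definition dac (V : finType) (e : rel V) : nat :=
  (\max_(k < #|V|.+1 | `[< dac_colorable e k >]) k)%N.

Lemma dac_max (V : finType) (e : rel V) (k : nat) :
  dac_colorable e k -> (k <= dac e)%N.
Proof.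
move=> ek; have kV : (k < #|V|.+1)%N.
  case: ek => c [sc _ _]; rewrite ltnS -[k]card_ord.
  have /choice[g gK] : forall i, exists x, c x = i by [].
  exact: (leq_card g (can_inj gK)).
by apply: (@leq_bigmax_cond _ _ (fun i : 'I_#|V|.+1 => i : nat) (Ordinal kV)); apply/asboolP.
Qed.

Lemma dac_attained (V : finType) (e : rel V) (k : nat) :
  dac_colorable e k -> dac_colorable e (dac e).
Proof.
move=> ek; have := dac_max ek; rewrite leq_eqVlt => /predU1P[<- //|kd].
rewrite /dac; have [|i Pi ->] := @eq_bigmax_cond _
  [pred k : 'I_#|V|.+1 | `[< dac_colorable e k >]] (fun i => i : nat).
  rewrite lt0n; apply/eqP => P0; move: kd; rewrite /dac big_pred0 // => i.
  exact: (card0_eq P0 i).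
exact/asboolP.
Qed.

(* Main.v *)
Require Import Defs.
From mathcomp Require Import all_boot all_order all_algebra.
From mathcomp Require Import all_classical all_reals all_analysis.
From mathcomp Require Import zify ring lra.
(* Finite sets, and not classical ones, own the set-theoretic names below. *)
From mathcomp Require Import fintype finset.

Set Implicit Arguments.
Unset Strict Implicit.
Unset Printing Implicit Defensive.

Import Order.TTheory GRing.Theory Num.Theory.

(** The upper bound holds because two singleton classes are joined by a single
    arc, so a complete coloring of a tournament has at most one singleton class
    ([dac_colorable_leq]).

    For the lower bound it is enough to produce pairwise disjoint nonempty
    acyclic sets, any two of which are joined by arcs in both directions
    ([complete_family]), not necessarily covering the vertices: a leftover
    vertex either forms a new class, or has arcs in at most one direction with
    some class, and joining that class then closes no directed cycle
    ([complete_family_extend]).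

    Such sets come from dominating sets. In a tournament some vertex [a] is
    dominated by at most half of the others; taking [a] and recursing into
    its in-neighbours gives a transitive dominating set with at most [p]
    elements as soon as the order is less than [2 ^ p.+1 - 1]
    ([dominating_acyclic_set]). Removing such sets one after the other yields a
    sequence of acyclic sets in which each set sends an arc to every later one
    ([forward_chain]).

    A forward chain of length [m] gives at least [m / 2] classes
    ([forward_chain_half]). Let [A] be its first set. If every later set sends
    an arc back to [A], then [A] is a class by itself. Otherwise merge [A] with
    the last set [B] that sends no arc back to [A]: the union is acyclic, sets
    after [B] send arcs back to [A], and sets before [B] send arcs to [B]. So
    the new class is linked both ways to whatever is built from the rest.

    There remains to count the sets of a chain. With [n] vertices left and
    [2 ^ p <= n + 1 < 2 ^ p.+1], one set of at most [p] vertices is removed, and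
    the inequality [n * ln 2 <= m * ln (2 * (n + 1) / 3)] between the order and
    the length [m] of the chain survives this step ([ln_bound_step]). It can
    be started at orders 4 and 5 with [m = 3]. At order 3 a chain may have only
    two sets, and the bound comes instead from a path on three vertices, which
    gives two classes ([dac_ge2]). *)

(** * Acyclic sets and arcs between sets *)

Lemma disjoint_setU (T : finType) (A B C : {set T}) :
  [disjoint A :|: B & C] = [disjoint A & C] && [disjoint B & C].
Proof. by rewrite !disjoints_subset subUset. Qed.

Definition acyclic_set (V : finType) (e : rel V) (A : {set V}) : Prop :=
  forall p : seq V, p <> [::] -> ucycle e p -> ~ {subset p <= A}.

Definition linked (V : finType) (e : rel V) (A B : {set V}) : bool :=
  [exists x in A, [exists y in B, e x y]].

Lemma linkedP (V : finType) (e : rel V) (A B : {set V}) :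
  reflect (exists x y, [/\ x \in A, y \in B & e x y]) (linked e A B).
Proof.
apply: (iffP exists_inP) => [[x xA /exists_inP[y yB exy]]|[x [y [xA yB exy]]]].
  by exists x, y.
by exists x => //; apply/exists_inP; exists y.
Qed.

Lemma linkedS (V : finType) (e : rel V) (A A' B B' : {set V}) :
  A \subset A' -> B \subset B' -> linked e A B -> linked e A' B'.
Proof.
move=> /subsetP sA /subsetP sB /linkedP[x [y [xA yB exy]]].
by apply/linkedP; exists x, y; split; auto.
Qed.

Lemma acyclic_set0 (V : finType) (e : rel V) : acyclic_set e set0.
Proof.
by move=> [|x p] // _ _ /(_ x); rewrite mem_head inE => /(_ isT).
Qed.

Lemma acyclic_set1 (V : finType) (e : rel V) (x : V) :
  irreflexive e -> acyclic_set e [set x].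
Proof.
move=> irr [|y [|z p]] // _ /andP[cyc un] sub.
  by move: cyc; rewrite /= irr.
have /set1P yx := sub y (mem_head _ _).
have /set1P zx : z \in [set x] by apply: sub; rewrite !inE eqxx orbT.
by move: un; rewrite yx zx /= mem_head.
Qed.

(** A directed cycle that meets [B] can never leave it, since no arc goes from
    [B] to [A]; so it lies in [A] or in [B]. *)
Lemma acyclic_setU (V : finType) (e : rel V) (A B : {set V}) :
  acyclic_set e A -> acyclic_set e B -> ~~ linked e B A ->
  acyclic_set e (A :|: B).
Proof.
move=> acA acB nBA p p0 cyc sub.
have stay y q : y \in B -> path e y q -> {subset q <= A :|: B} ->
    {subset q <= B}.
  elim: q y => [|z q IHq] y yB //= /andP[eyz zq] qs.
  have zB : z \in B.
    have /setUP[zA|//] := qs z (mem_head _ _).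
    by case/negP: nBA; apply/linkedP; exists y, z.
  move=> u; rewrite inE => /predU1P[->//|uq].
  by apply: (IHq z) uq => // w wq; apply: qs; rewrite inE wq orbT.
have [/hasP[b bp bB]|/hasPn nB] := boolP (has (mem B) p); last first.
  apply: (acA p) => // x xp.
  by have /setUP[//|xB] := sub x xp; have := nB x xp; rewrite /= xB.
apply: (acB p) => // x xp.
have [i q def_p] := rot_to bp.
have : ucycle e (b :: q) by rewrite -def_p rot_ucycle.
case/andP=> /= pq _; apply: (stay b (rcons q b)) => //.
  move=> u; rewrite mem_rcons => ubq.
  by apply: sub; rewrite -(mem_rot i) def_p.
by rewrite mem_rcons -def_p mem_rot.
Qed.

(** * Partial complete acyclic colorings *)

(** The classes of a complete acyclic coloring of the subdigraph induced by
    [cover P]; since the linking condition ranges over ordered pairs, it asks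
    for arcs in both directions. *)
Definition complete_family (V : finType) (e : rel V) (P : {set {set V}}) : Prop :=
  [/\ set0 \notin P, trivIset P, forall A, A \in P -> acyclic_set e A &
      forall A B, A \in P -> B \in P -> A != B -> linked e A B].

Lemma complete_family0 (V : finType) (e : rel V) : complete_family e set0.
Proof.
by split=> [||A|A B]; rewrite ?inE //; apply/trivIsetP=> A B; rewrite inE.
Qed.

Lemma complete_familyS (V : finType) (e : rel V) (P Q : {set {set V}}) :
  Q \subset P -> complete_family e P -> complete_family e Q.
Proof.
move=> sQP [P0 triv acP linkP]; have /subsetP sub := sQP; split.
- by apply: contra P0 => /sub.
- exact: trivIsetS triv.
- by move=> A /sub; exact: acP.
- by move=> A B /sub AP /sub BP; exact: linkP.
Qed.

Lemma complete_familyU1 (V : finType) (e : rel V) (P : {set {set V}})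
    (A : {set V}) :
  complete_family e P -> A != set0 -> acyclic_set e A ->
  (forall B, B \in P -> [/\ [disjoint A & B], linked e A B & linked e B A]) ->
  complete_family e (A |: P) /\ #|A |: P| = #|P|.+1.
Proof.
move=> [P0 triv acP linkP] A0 acA AP.
have [trivA nAP] : trivIset (A |: P) /\ A \notin P.
  by apply: trivIsetU1 => // B /AP[].
split; last by rewrite cardsU1 nAP.
split=> //.
- by rewrite !inE eq_sym negb_or A0.
- by move=> B /setU1P[->//|]; exact: acP.
- move=> B C /setU1P[->|BP] /setU1P[->|CP]; first by rewrite eqxx.
  + by have [] := AP C CP.
  + by have [] := AP B BP.
  + exact: linkP.
Qed.

(** Vertices are absorbed one at a time. A vertex linked in both directions to
    every class becomes a class; otherwise it is added to a class with which it
    is linked in at most one direction, which keeps that class acyclic, while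
    enlarging a class cannot destroy the links it already has. *)
Lemma complete_family_extend (V : finType) (e : rel V) (P : {set {set V}}) :
  irreflexive e -> complete_family e P ->
  exists Q, [/\ complete_family e Q, #|P| <= #|Q| & cover Q = setT].
Proof.
move=> irr; have [N] := ubnP #|~: cover P|.
elim: N P => // N IHN P ltN famP.
have [/setP covP|] := eqVneq (~: cover P) set0.
  exists P; split=> //; apply/setP=> x.
  by have := covP x; rewrite !inE => /negbFE.
case/set0Pn=> v; rewrite inE => nv.
have vB (B : {set V}) : B \in P -> v \notin B.
  by move=> BP; apply: contra nv => vB; apply/bigcupP; exists B.
suff [Q [famQ cardQ subQ vQ]] : exists Q, [/\ complete_family e Q,
    #|P| <= #|Q|, cover P \subset cover Q & v \in cover Q].
  have [||Q' [famQ' cardQ' covQ']] := IHN Q => //.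
    apply: leq_ltn_trans (_ : #|(~: cover P) :\ v| < N).
      apply: subset_leq_card; apply/subsetP=> x; rewrite !inE => xQ.
      rewrite (contra (subsetP subQ x) xQ) andbT.
      by apply: contraNneq xQ => ->.
    by move: ltN; rewrite (cardsD1 v (~: _)) inE nv add1n ltnS.
  by exists Q'; split=> //; apply: leq_trans cardQ'.
have ac1 : acyclic_set e [set v] by exact: acyclic_set1.
have [P0 triv acP linkP] := famP.
have [/exists_inP[C CP nlink]|] := boolP
    [exists C in P, ~~ (linked e C [set v] && linked e [set v] C)]; last first.
  rewrite negb_exists_in => /forall_inP all_linked.
  have [|C CP|famQ cardQ] :=
      @complete_familyU1 V e P [set v] famP _ ac1.
  - by apply/set0Pn; exists v; rewrite inE.
  - have := all_linked C CP; rewrite negbK => /andP[-> ->].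
    by rewrite disjoints1 vB.
  exists ([set v] |: P); split=> //; first by rewrite cardQ.
    by apply/subsetP=> x /bigcupP[B BP xB]; apply/bigcupP; exists B; rewrite ?inE ?BP ?orbT.
  by apply/bigcupP; exists [set v]; rewrite ?inE ?eqxx.
have acC : acyclic_set e (v |: C).
  move: nlink; rewrite negb_and => /orP[n1|n1].
    by apply: acyclic_setU => //; exact: acP.
  by rewrite setUC; apply: acyclic_setU => //; exact: acP.
have [||B /setD1P[BC BP]|famQ cardQ] :=
    @complete_familyU1 V e (P :\ C) (v |: C) _ _ acC.
- exact: complete_familyS (subD1set _ _) famP.
- by apply/set0Pn; exists v; rewrite !inE eqxx.
- have sub := subsetUr [set v] C; split.
  + rewrite disjoint_setU disjoints1 vB //=; apply: (trivIsetP triv) => //.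
    by rewrite eq_sym.
  + by apply: linkedS sub (subxx B) _; apply: linkP; rewrite // eq_sym.
  + by apply: linkedS (subxx B) sub _; apply: linkP.
exists ((v |: C) |: P :\ C); split=> //.
- by rewrite cardQ (cardsD1 C P) CP.
- apply/subsetP=> x /bigcupP[B BP xB]; apply/bigcupP.
  have [eBC|BC] := eqVneq B C; last by exists B; rewrite // !inE BC BP orbT.
  by exists (v |: C); rewrite ?inE ?eqxx // -eBC xB orbT.
- by apply/bigcupP; exists (v |: C); rewrite !inE eqxx.
Qed.

Lemma complete_family_colorable (V : finType) (e : rel V) (P : {set {set V}}) :
  complete_family e P -> cover P = setT -> dac_colorable e #|P|.
Proof.
move=> [P0 triv acP linkP] covP.
have blockP x : pblock P x \in P by rewrite pblock_mem // covP inE.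
pose c x : 'I_#|P| := enum_rank_in (blockP x) (pblock P x).
have cK x : enum_val (c x) = pblock P x by apply: enum_rankK_in.
have cE x (i : 'I_#|P|) : x \in enum_val i -> c x = i.
  move=> xi; apply: enum_val_inj; rewrite cK.
  by apply: def_pblock => //; exact: enum_valP.
exists c; split.
- move=> i; have iP := enum_valP i.
  have /set0Pn[x xi] : enum_val i != set0 by apply: contraNneq P0 => <-.
  by exists x; exact: cE.
- move=> i [p [p0 cyc pi]]; apply: (acP _ (enum_valP i) p p0 cyc) => x xp.
  by rewrite -(pi x xp) cK mem_pblock covP inE.
- move=> i j ij; have [||//|x [y [xi yj exy]]] :=
    linkedP _ _ _ (linkP (enum_val i) (enum_val j) _ _ _).
  + exact: enum_valP.
  + exact: enum_valP.
  + by rewrite (inj_eq enum_val_inj).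
  + by exists x, y; split=> //; exact: cE.
Qed.

Lemma complete_family_dac (V : finType) (e : rel V) (P : {set {set V}}) :
  irreflexive e -> complete_family e P -> #|P| <= dac e.
Proof.
move=> irr /(complete_family_extend irr)[Q [famQ PQ covQ]].
exact: leq_trans PQ (dac_max (complete_family_colorable famQ covQ)).
Qed.

(** * Merging a chain of sets into a complete family *)

Definition forward_chain (V : finType) (e : rel V) (s : seq {set V}) : Prop :=
  [/\ forall A, A \in s -> A != set0 /\ acyclic_set e A &
      pairwise (fun A B : {set V} => [disjoint A & B] && linked e A B) s].

Lemma forward_chain_subseq (V : finType) (e : rel V) (s t : seq {set V}) :
  subseq s t -> forward_chain e t -> forward_chain e s.
Proof.
move=> st [act pt]; split; last exact: subseq_pairwise st pt.
by move=> A /(mem_subseq st); exact: act.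
Qed.

(** Splitting at the last, and not the first, element that satisfies [a]. *)
Lemma last_has (T : Type) (a : pred T) (s : seq T) :
  has a s -> exists s1 x s2, [/\ s = s1 ++ x :: s2, a x & ~~ has a s2].
Proof.
elim: s => //= x s IHs; have [has_s _|no_s] := boolP (has a s).
  have [s1 [y [s2 [-> ay no_s2]]]] := IHs has_s.
  by exists (x :: s1), y, s2.
by rewrite orbF => ax; exists [::], x, s.
Qed.

(** [P] is obtained from [s] by taking unions of members of [s]. Only two
    consequences matter: links with members of [s] pass to classes of [P], and
    so does disjointness from all of [s]. *)
Definition coarsens (V : finType) (P : {set {set V}}) (s : seq {set V}) : Prop :=
  (forall C, C \in P -> exists2 A, A \in s & A \subset C) /\
  (forall D : {set V}, (forall A, A \in s -> [disjoint D & A]) ->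
    forall C, C \in P -> [disjoint D & C]).

(** The first set is used up together with at most one other set, and the
    class that they form is linked in both directions to every remaining set,
    hence to every class built from the remaining sets. *)
Lemma forward_chain_half (V : finType) (e : rel V) (s : seq {set V}) :
  forward_chain e s ->
  exists P, [/\ complete_family e P, size s <= #|P|.*2 & coarsens P s].
Proof.
have [N] := ubnP (size s); elim: N s => // N IHN [_ _|A s ltN chs].
  exists set0; split=> //; first exact: complete_family0.
  by split=> [C|D _ C]; rewrite inE.
have [acs /= /andP[/allP As prs]] := chs.
have [A0 acA] := acs A (mem_head _ _).
(* [X] is the class that contains [A], and [t] the sets left for the rest. *)
have step t (X : {set V}) : subseq t s -> A \subset X -> acyclic_set e X ->
    size s <= (size t).+1 ->
    (forall B, B \in t -> [/\ [disjoint X & B], linked e X B & linked e B X]) ->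
    (forall D : {set V}, (forall A', A' \in A :: s -> [disjoint D & A']) ->
      [disjoint D & X]) ->
    exists P, [/\ complete_family e P, (size s).+1 <= #|P|.*2 &
      coarsens P (A :: s)].
  move=> ts AX acX szt Xt DX.
  have [||P [famP szP [supP disP]]] := IHN t.
  - exact: leq_ltn_trans (size_subseq ts) ltN.
  - exact: forward_chain_subseq (subseq_trans ts (subseq_cons s A)) chs.
  have [|C CP|famQ cardQ] := @complete_familyU1 V e P X famP _ acX.
  - by apply: contraNneq A0 => X0; rewrite -subset0 -X0.
  - have [B Bt BC] := supP C CP; have [_ XB BX] := Xt B Bt; split.
    + by apply: disP CP => B' /Xt[].
    + exact: linkedS (subxx X) BC XB.
    + exact: linkedS BC (subxx X) BX.
  exists (X |: P); split=> //.
    by rewrite cardQ doubleS !ltnS (leq_trans szt) // ltnS.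
  split.
  - move=> C /setU1P[->|/supP[B Bt BC]]; first by exists A; rewrite ?mem_head.
    by exists B => //; rewrite inE (mem_subseq ts) // orbT.
  - move=> D disD C /setU1P[->|]; first exact: DX.
    by apply: disP => B Bt; apply: disD; rewrite inE (mem_subseq ts) // orbT.
have [hasB|/hasPn noB] := boolP (has (fun B => ~~ linked e B A) s); last first.
  apply: (step s A) => // [B Bs|D disD].
    by have /andP[-> ->] := As B Bs; have := noB B Bs; rewrite negbK.
  by apply: disD; rewrite mem_head.
have [s1 [B [s2 [defs nBA /hasPn linkA]]]] := last_has hasB.
have Bs : B \in s by rewrite defs mem_cat mem_head orbT.
have [B0 acB] : B != set0 /\ acyclic_set e B by apply: acs; rewrite inE Bs orbT.
have sub12 : subseq (s1 ++ s2) s.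
  by rewrite defs cat_subseq // subseq_cons.
apply: (step (s1 ++ s2) (A :|: B)) => //.
- exact: subsetUl.
- exact: acyclic_setU.
- by rewrite defs !size_cat /= addnS.
- move=> C Ct; have Cs := mem_subseq sub12 Ct.
  have /andP[dAC lAC] := As C Cs.
  have sAU := subsetUl A B; have sBU := subsetUr A B.
  have lUC := linkedS sAU (subxx C) lAC.
  move: prs; rewrite defs pairwise_cat /= => /and4P[/allrelP r1 _ /allP r2 _].
  move: Ct; rewrite mem_cat => /orP[C1|C2].
    have /andP[dCB lCB] := r1 C B C1 (mem_head _ _).
    split=> //; last exact: linkedS (subxx C) sBU lCB.
    by rewrite disjoint_setU dAC disjoint_sym.
  have /andP[dBC lBC] := r2 C C2.
  split=> //; first by rewrite disjoint_setU dAC.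
  by apply: linkedS (subxx C) sAU _; have := linkA C C2; rewrite negbK.
- move=> D disD; rewrite disjoint_sym disjoint_setU ![[disjoint _ & D]]disjoint_sym.
  by rewrite !disD // inE ?eqxx // Bs orbT.
Qed.

(** * Dominating acyclic sets *)

(** In-degrees and out-degrees within [S] have the same sum, so they cannot all
    satisfy [outdegree < indegree]. *)
Lemma exists_small_indegree (V : finType) (e : rel V) (S : {set V}) :
  tournament e -> S != set0 ->
  exists2 a, a \in S & #|[set x in S | e x a]|.*2 < #|S|.
Proof.
move=> [irr tour] S0.
pose indeg a := #|[set x in S | e x a]|.
pose outdeg a := #|[set x in S | e a x]|.
have degE a : a \in S -> indeg a + outdeg a = #|S|.-1.
  move=> aS; rewrite (cardsD1 a S) aS /= -cardsUI.
  rewrite [X in _ + #|pred_of_set X|](_ : _ = set0) ?cards0 ?addn0; last first.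
    apply/setP=> x; rewrite !inE; apply: contraTF isT => /andP[/andP[xS exa] /andP[_ eax]].
    have [exa'|ne] := eqVneq x a; first by rewrite exa' irr in exa.
    by have := tour x a ne; rewrite exa eax.
  apply: eq_card => x; rewrite !inE -andb_orr.
  have [->|ne] := eqVneq x a; first by rewrite !irr andbF.
  have := tour x a ne; case: (x \in S) => //=.
  by case: (e x a); case: (e a x).
have sum_eq : \sum_(a in S) indeg a = \sum_(a in S) outdeg a.
  have countE (P : pred V) : #|[set x in S | P x]| = \sum_(x in S) P x.
    by rewrite -sum1dep_card big_mkcondr; apply: eq_bigr => x _; case: (P x).
  under eq_bigr do rewrite /indeg countE.
  under [RHS]eq_bigr do rewrite /outdeg countE.
  exact: exchange_big.
have [/exists_inP[a aS lea]|] := boolP [exists a in S, indeg a <= outdeg a].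
  exists a => //; have := degE a aS; rewrite -/(indeg a).
  have : 0 < #|S| by rewrite card_gt0.
  lia.
rewrite negb_exists_in => /forall_inP all_lt; exfalso.
move: S0; rewrite -card_gt0 => S0.
have : \sum_(a in S) (outdeg a + 1) <= \sum_(a in S) indeg a.
  by apply: leq_sum => a aS; rewrite addn1 ltnNge all_lt.
rewrite sum_eq big_split /= sum1_card; lia.
Qed.

(** Induction on [p]: besides its out-neighbours, which [a] dominates, [S]
    consists of [a] and fewer than [#|S| / 2] in-neighbours of [a], to which
    the induction applies. All arcs between [a] and the recursively chosen set
    point to [a], so no cycle arises. *)
Lemma dominating_acyclic_set (V : finType) (e : rel V) (p : nat) (S : {set V}) :
  tournament e -> #|S|.+1 < 2 ^ p.+1 ->
  exists A : {set V}, [/\ A \subset S, acyclic_set e A, #|A| <= p &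
    forall x, x \in S :\: A -> exists2 a, a \in A & e a x].
Proof.
move=> tour; have [irr arc] := tour; elim: p S => [|p IHp] S szS.
  have S0 : S = set0 by apply: cards0_eq; move: szS; rewrite expn1; lia.
  exists set0; rewrite S0 subxx cards0; split=> // [|x]; last by rewrite !inE.
  exact: acyclic_set0.
have [S0|S0] := eqVneq S set0.
  exists set0; rewrite S0 subxx cards0; split=> // [|x]; last by rewrite !inE.
  exact: acyclic_set0.
have [a aS dega] := exists_small_indegree tour S0.
have [|A [sA acA szA domA]] := IHp [set x in S | e x a].
  by move: szS; rewrite (expnS 2 p.+1); lia.
exists (A :|: [set a]); split.
- apply/subsetP=> x /setUP[/(subsetP sA)|/set1P->//].
  by rewrite inE => /andP[].
- apply: acyclic_setU => //; first exact: acyclic_set1.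
  apply/linkedP=> -[x [y [/set1P-> yA eay]]].
  have := subsetP sA y yA; rewrite inE => /andP[_ eya].
  have [ya|ne] := eqVneq y a; first by rewrite ya irr in eya.
  by have := arc y a ne; rewrite eya eay.
- by rewrite (leq_trans (leq_card_setU _ _)) // cards1 addn1.
- move=> x; rewrite !inE negb_or => /andP[/andP[xA xa] xS].
  have := arc x a xa; have [exa _|_ /= eax] := boolP (e x a).
    have [|b bA ebx] := domA x; first by rewrite !inE xA xS exa.
    by exists b => //; rewrite inE bA.
  by exists a => //; rewrite !inE eqxx orbT.
Qed.

(** * Extracting forward chains *)

Definition has_chains (V : finType) (e : rel V) (n m : nat) : Prop :=
  forall S : {set V}, n <= #|S| -> exists s : seq {set V},
    [/\ forward_chain e s, size s = m & forall A, A \in s -> A \subset S].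

Lemma has_chains0 (V : finType) (e : rel V) : has_chains e 0 0.
Proof. by move=> S _; exists [::]. Qed.

Lemma has_chains_leq (V : finType) (e : rel V) (n n' m : nat) :
  n <= n' -> has_chains e n m -> has_chains e n' m.
Proof. by move=> nn' chn S szS; apply: chn; apply: leq_trans szS. Qed.

Lemma has_chainsS (V : finType) (e : rel V) (n m p : nat) :
  tournament e -> 0 < n -> n.+1 < 2 ^ p.+1 -> has_chains e (n - p) m ->
  has_chains e n m.+1.
Proof.
move=> tour n0 np chn S szS.
have [S' sS cardS] : exists2 S' : {set V}, S' \subset S & #|S'| = n.
  exists [set x in take n (enum S)].
    by apply/subsetP=> x; rewrite inE => /mem_take; rewrite mem_enum.
  rewrite cardsE (card_uniqP _) ?take_uniq ?enum_uniq // size_take -cardE.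
  by case: ltngtP szS => // <-.
have [|A [sA acA szA domA]] := @dominating_acyclic_set V e p S' tour.
  by rewrite cardS.
have [|s [[acs prs] szs subs]] := chn (S' :\: A).
  by rewrite cardsD (setIidPr sA) cardS leq_sub2l.
have A0 : A != set0.
  apply: contraTneq n0 => A0; rewrite -cardS -leqNgt leqn0 cards_eq0.
  apply/eqP/setP=> x; rewrite inE; apply/negP=> xS.
  by have [|a] := domA x; rewrite A0 !inE ?xS.
exists (A :: s); split=> /=; last 2 first.
- by rewrite szs.
- move=> B; rewrite inE => /predU1P[->|/subs sB].
    exact: subset_trans sA sS.
  exact: subset_trans sB (subset_trans (subsetDl _ _) sS).
split=> [B|/=].
  by rewrite inE => /predU1P[->|/acs].
rewrite prs andbT; apply/allP=> B Bs; have [B0 _] := acs B Bs.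
have sB := subs B Bs; apply/andP; split.
  rewrite disjoint_sym disjoints_subset; apply: subset_trans sB _.
  by rewrite setDE subsetIr.
have /set0Pn[x xB] := B0.
have [a aA eax] := domA x (subsetP sB x xB).
by apply/linkedP; exists a, x.
Qed.


(** * Two classes from a path, and the upper bound *)

(** A set of two vertices of a tournament spans a single arc, hence is acyclic. *)
Lemma path_complete_family (V : finType) (e : rel V) (x c y : V) :
  tournament e -> e x c -> e c y -> x != y ->
  complete_family e [set [set c]; [set x; y]] /\
  #|[set [set c]; [set x; y]]| = 2.
Proof.
move=> [irr tour] exc ecy xy.
have cx : c != x by apply: contraTneq exc => ->; rewrite irr.
have cy : c != y by apply: contraTneq ecy => ->; rewrite irr.
have ac1 v : acyclic_set e [set v] by exact: acyclic_set1.
have [||B|fam1 card1] :=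
    @complete_familyU1 V e set0 [set x; y] (complete_family0 e).
- by apply/set0Pn; exists x; rewrite !inE eqxx.
- have not_linked1 u v : ~~ e u v -> ~~ linked e [set u] [set v].
    by apply: contra => /linkedP[_ [_ [/set1P-> /set1P->]]].
  have := tour x y xy; have [exy /= nyx|nxy _] := boolP (e x y).
    by apply: acyclic_setU; rewrite ?not_linked1.
  by rewrite setUC; apply: acyclic_setU; rewrite ?not_linked1.
- by rewrite inE.
rewrite setU0 cards0 in fam1 card1.
have [||B /set1P->|fam2 card2] := @complete_familyU1 V e _ [set c] fam1.
- by apply/set0Pn; exists c; rewrite inE.
- exact: ac1.
- rewrite disjoints1 !inE negb_or cx cy; split=> //; apply/linkedP.
    by exists c, y; rewrite !inE !eqxx orbT.
  by exists x, c; rewrite !inE !eqxx.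
by rewrite card2 card1.
Qed.

(** Among three vertices, one is neither a source nor a sink of the triangle
    that they span. *)
Lemma exists_through_path (V : finType) (e : rel V) :
  tournament e -> 2 < #|V| -> exists x c y, [/\ e x c, e c y & x != y].
Proof.
move=> [irr tour] V3.
have [a [b [c [ab bc ca]]]] : exists a b c : V, [/\ a != b, b != c & c != a].
  have := enum_uniq V; move: V3; rewrite cardE.
  case: (enum V) => [|a [|b [|c s]]] //= _; rewrite !inE !negb_or.
  case/and3P=> /and3P[ab ac _] /andP[bc _] _; exists a, b, c.
  by rewrite ab bc eq_sym ac.
have dir u v : u != v -> e u v || e v u.
  by move/tour; case: (e u v); case: (e v u).
have [/orP[eab|eba] /orP[ebc|ecb]] := (dir a b ab, dir b c bc).
- by exists a, b, c; rewrite eq_sym.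
- have /orP[eca|eac] := dir c a ca; first by exists c, a, b; rewrite eq_sym.
  by exists a, c, b.
- have /orP[eca|eac] := dir c a ca; first by exists b, c, a; rewrite eq_sym.
  by exists b, a, c.
- by exists c, b, a.
Qed.

Lemma dac_ge2 (V : finType) (e : rel V) :
  tournament e -> 2 < #|V| -> 1 < dac e.
Proof.
move=> tour V3; have [x [c [y [exc ecy xy]]]] := exists_through_path tour V3.
have [fam card2] := path_complete_family tour exc ecy xy.
by rewrite -card2; apply: complete_family_dac fam; case: tour.
Qed.

(** Two singleton classes would need two opposite arcs between their vertices.
    Hence at most one class has size 1, and [k.*2 <= #|V| + 1]. *)
Lemma dac_colorable_leq (V : finType) (e : rel V) (k : nat) :
  tournament e -> dac_colorable e k -> k.*2 <= #|V|.+1.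
Proof.
move=> [irr tour] [c [sur _ com]].
have cardV : #|V| = \sum_(i < k) #|[set x | c x == i]|.
  rewrite -sum1_card (partition_big c predT) //=.
  by apply: eq_bigr => i _; rewrite -sum1dep_card.
have pos i : 0 < #|[set x | c x == i]|.
  by have [x cx] := sur i; rewrite card_gt0; apply/set0Pn; exists x; rewrite inE cx.
have single i j : #|[set x | c x == i]| = 1 -> #|[set x | c x == j]| = 1 -> i = j.
  move=> /eqP/cards1P[x ix] /eqP/cards1P[y jy]; apply/eqP; apply: contraT => ij.
  have inx z : c z = i -> z = x.
    by move=> cz; apply/set1P; rewrite -ix inE cz.
  have iny z : c z = j -> z = y.
    by move=> cz; apply/set1P; rewrite -jy inE cz.
  have [u [v [exy cu cv]]] := com i j ij.
  have [v' [u' [eyx cv' cu']]] := com j i (contra_neq (@esym _ _ _) ij).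
  rewrite (inx u cu) (iny v cv) in exy; rewrite (inx u' cu') (iny v' cv') in eyx.
  have xy : x != y by apply: contraTneq exy => ->; rewrite irr.
  by have := tour x y xy; rewrite exy eyx.
have few : #|[set i | #|[set x | c x == i]| == 1]| <= 1.
  by apply/card_le1_eqP=> i j; rewrite !inE => /eqP i1 /eqP j1; exact: single.
have : \sum_(i < k) 2 <=
    \sum_(i < k) (#|[set x | c x == i]| + (#|[set x | c x == i]| == 1)).
  by apply: leq_sum => i _; have := pos i; case: #|_| => [|[|m]].
have -> : \sum_(i < k) (#|[set x | c x == i]| + (#|[set x | c x == i]| == 1)) =
    #|V| + #|[set i | #|[set x | c x == i]| == 1]|.
  rewrite big_split /= -cardV; congr (_ + _).
  by rewrite -sum1dep_card [RHS]big_mkcond; apply: eq_bigr => i _; case: (_ == 1).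
rewrite sum_nat_const card_ord; lia.
Qed.

Lemma dac_leq (V : finType) (e : rel V) :
  tournament e -> (dac e).*2 <= #|V|.+1.
Proof.
move=> tour; suff : dac e <= (#|V|.+1)./2 by lia.
apply/bigmax_leqP=> k /asboolP colk.
by have := dac_colorable_leq tour colk; lia.
Qed.

(** * Counting the sets of a chain *)

(** Sets of sizes at most 2, 1 and 1 are removed in turn. *)
Lemma has_chains4 (V : finType) (e : rel V) : tournament e -> has_chains e 4 3.
Proof.
move=> tour; have ch1 : has_chains e 1 1.
  by apply: (@has_chainsS V e 1 0 1) => //; exact: has_chains0.
have ch2 : has_chains e 2 2 by apply: (@has_chainsS V e 2 1 1).
by apply: (@has_chainsS V e 4 2 2).
Qed.

Lemma has_chains_dac (V : finType) (e : rel V) (n m : nat) :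
  tournament e -> has_chains e n m -> n <= #|V| -> m <= (dac e).*2.
Proof.
move=> tour chn nV; have [|s [chs <- _]] := chn [set: V]; first by rewrite cardsT.
have [P [famP szP _]] := forward_chain_half chs.
apply: leq_trans szP _; rewrite leq_double.
by apply: complete_family_dac => //; case: tour.
Qed.

Local Open Scope ring_scope.

(** Write [L n] for [ln (2 * (n + 1) / 3)]. Since [2 ^ p <= n + 1], the new set
    contributes [L n >= p * ln 2 - ln (3 / 2) >= p * ln 2 - 1 / 2], at most
    [1 / 2] short of the [p * ln 2] that is needed. The deficit is made up by
    the [m] earlier terms, each of which grows by
    [L n - L (n - p) >= p / (n + 1)]; if [L n < p * ln 2] then the hypothesis
    forces [m * p >= n - p >= (n + 1) / 2], so that the total growth is at
    least [1 / 2]. *)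
Lemma ln_bound_step (R : realType) (n m p : nat) :
  (2 ^ p <= n.+1)%N -> (p.*2.+1 <= n)%N ->
  (n - p)%:R * ln 2 <= m%:R * ln ((2 * (n - p)%:R + 2) / 3) :> R ->
  n%:R * ln 2 <= m.+1%:R * ln ((2 * n%:R + 2) / 3) :> R.
Proof.
move=> pn p2n.
have pR : (2 : R) ^+ p <= n%:R + 1 by rewrite -natrX natr1 ler_nat.
have p2nR : 2 * p%:R + 1 <= n%:R :> R.
  by rewrite -natrM natr1 ler_nat mul2n.
rewrite natrB; last by lia.
set L' := ln ((2 * (_ - _) + 2) / 3); set L := ln ((2 * n%:R + 2) / 3); move=> IH.
have p0 : 0 <= p%:R :> R by [].
have ln2 : 0 < ln 2 :> R by apply: ln_gt0; rewrite ltr1n.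
have lnB (a b : R) : 0 < a -> 0 < b -> ln a - ln b <= (a - b) / b.
  move=> a0 b0; rewrite -ln_div ?posrE //.
  have -> : a / b = 1 + (a - b) / b by field; rewrite gt_eqF.
  apply: le_ln1Dx; rewrite mulrBl divff ?gt_eqF //.
  by have := divr_gt0 a0 b0; lra.
have L'L : L' - L <= - (p%:R / (n%:R + 1)).
  apply: le_trans (lnB _ _ _ _) _; try by lra.
  by rewrite le_eqVlt; apply/orP; left; apply/eqP; field; lra.
have Lp : p%:R * ln 2 - 1 / 2 <= L.
  have : ln (2 ^+ p) - L <= 1 / 2.
    apply: le_trans (lnB _ _ _ _) _; [exact: exprn_gt0|lra|].
    by rewrite ler_pdivrMr; lra.
  by rewrite lnXn // -mulr_natl; lra.
have m0 : 0 <= m%:R :> R by [].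
set q := p%:R / (n%:R + 1) in L'L.
have mq : m%:R * q <= m%:R * (L - L') by apply: ler_wpM2l => //; lra.
rewrite -natr1.
have [Lge|Llt] := leP (p%:R * ln 2) L.
  have : 0 <= m%:R * q by rewrite mulr_ge0 // divr_ge0 //; lra.
  lra.
suff : 1 / 2 <= m%:R * q by nra.
have q0 : 0 <= q by rewrite divr_ge0 //; lra.
have : (n%:R - p%:R) * ln 2 <= m%:R * p%:R * ln 2 :> R.
  apply: le_trans IH _; rewrite -[leRHS]mulrA; apply: ler_wpM2l => //; lra.
rewrite ler_pM2r // => nmp.
rewrite /q mulrA ler_pdivlMr; lra.
Qed.

(** Integer form of the bound, decidable by computation for small orders. *)
Lemma ln_bound_base (R : realType) (n m : nat) :
  (3 ^ m * 2 ^ n <= (n.*2.+2) ^ m)%N ->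
  n%:R * ln 2 <= m%:R * ln ((2 * n%:R + 2) / 3) :> R.
Proof.
move=> nm; have -> : 2 * n%:R + 2 = n.*2.+2%:R :> R by rewrite -natrM -natrD mul2n addn2.
rewrite !(mulr_natl (ln _)) -!lnXn // ?divr_gt0 // ler_ln ?posrE ?exprn_gt0 ?divr_gt0 //.
rewrite expr_div_n ler_pdivlMr ?exprn_gt0 // -!natrX -natrM ler_nat mulnC //.
Qed.

(** From order 6 on, removing [p] vertices leaves at least 4, so that the
    induction never reaches order 3, where the bound on chains may fail. *)
Lemma has_chains_ln (R : realType) (V : finType) (e : rel V) (n : nat) :
  tournament e -> (3 < n)%N -> exists m,
    has_chains e n m /\ n%:R * ln 2 <= m%:R * ln ((2 * n%:R + 2) / 3) :> R.
Proof.
move=> tour; elim/ltn_ind: n => n IHn n4.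
have [n6|n6] := leqP 6 n; last first.
  exists 3%N; split; first exact: has_chains_leq (has_chains4 tour).
  apply: ln_bound_base; have : n = 4%N \/ n = 5%N by lia.
  by case=> ->.
have := trunc_log_bounds (ltnSn 1) (ltn0Sn n).
move: (trunc_log 2 n.+1) => p /= /andP[pn np].
have p2 : (2 <= p)%N.
  by move: np n6; case: (p) => [|[|//]]; lia.
have p2n : (p.*2.+1 <= n)%N.
  have [p3|p3] := leqP 3 p; last by lia.
  have : (p.*2.+2 <= 2 ^ p)%N.
    rewrite -(subnK p3); elim: (p - 3)%N => // k IHk.
    by rewrite addSn expnS doubleS; lia.
  lia.
have [||m [chm lem]] := IHn (n - p)%N; [lia|lia|].
exists m.+1; split; last exact: ln_bound_step lem.
by apply: has_chainsS chm => //; lia.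
Qed.

Theorem theorem11 (R : realType) (V : finType) (e : rel V) (n : nat)
    (tour : tournament e) (order : #|V| = n) (n_ge3 : (3 <= n)%N) :
  n%:R / (2 * log2 ((2 * n%:R + 2) / 3)) <= (dac e)%:R :> R /\
  (dac e)%:Z <= Num.ceil (n%:R / 2 : R).
Proof.
set X := (2 * _ + 2) / 3; have n3 : 3 <= n%:R :> R by rewrite ler_nat.
have X1 : 1 < X by rewrite /X; lra.
have lnX : 0 < ln X by exact: ln_gt0.
have ln2 : 0 < ln 2 :> R by apply: ln_gt0; rewrite ltr1n.
split.
  suff bound : n%:R * ln 2 <= (dac e)%:R * 2 * ln X.
    rewrite /log2 ler_pdivrMr ?mulr_gt0 ?invr_gt0 // !mulrA ler_pdivlMr //.
  have [n4|n4] := leqP 4 n; last first.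
    have n_eq : n = 3%N by lia.
    have dac2 := dac_ge2 tour; rewrite order in dac2.
    have := @ln_bound_base R 3 4 isT; rewrite -/X n_eq.
    move=> le4; apply: le_trans le4 _; rewrite /X n_eq in lnX *.
    rewrite ler_pM2r // -natrM ler_nat; lia.
  have [m [chm lem]] := has_chains_ln R tour n4.
  apply: le_trans lem _; rewrite ler_pM2r // -natrM ler_nat muln2.
  by apply: has_chains_dac chm _ => //; rewrite order.
have := dac_leq tour; rewrite order => dacn.
case: (posnP (dac e)) => [->|dac0]; first by rewrite ceil_ge0; lra.
rewrite -(prednK dac0) -addn1 PoszD lezD1 ceil_gt_int.
have : ((dac e).-1.*2.+1 <= n)%N by lia.
rewrite -(ler_nat R) -natr1 -mul2n natrM.
set k := (dac e).-1%:R; change ((dac e).-1%:~R) with k; lra.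
Qed.
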